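(* Let $a,b$ be a parallel pair of a generic regular closed curve $M$ in $\mathbb{R}^2$. Then $a-b$ and $b-a$ are inflexion points of $\mathrm{SC}(M)$ if and only if one of the points $a$, $b$ is an inflexion point of $M$.
   Context: A closed regular curve $M$ is the image of a $C^\infty$ immersion $f:S^1\to\mathbb{R}^2$. A parallel pair of $M$ is a pair of points $a,b\in M$, $a\neq b$, such that the tangent lines to $M$ at $a$ and $b$ are parallel. The secant caustic is $\mathrm{SC}(M)=\mathrm{cl}\{a-b : a,b \text{ is a parallel pair of } M\}$. A point of $M$ is an inflexion point if the signed curvature changes sign there; an undulation point is a point where the curvature vanishes without changing sign. An inflexion point $f(s_0)$ is non-degenerate if $\det(f'(s_0),f'''(s_0))\neq 0$. $M$ is parameterized in the same direction at $f(s_1)$ and $f(s_2)$ if $f'(s_1)=\alpha f'(s_2)$ with $\alpha>0$. $M$ is generic if: (i) $f$ is regular; (ii) $f$ has only non-degenerate inflexion points and no undulation points; (iii) $f$ has only transversal self-crossings; (iv) if $f(s_1),f(s_2)$ is a parallel pair then at least one of them is not an inflexion point; (v) if $f(s_1),f(s_2)$ with $s_1\neq s_2$ is a parallel pair and, for local arc length parameterizations near $s_1$ and $s_2$ chosen in the same direction, the signed curvatures at $f(s_1)$ and $f(s_2)$ are equal, then the derivatives of the curvatures with respect to arc length at these points are different. Near a parallel pair $a=f(s_1)$, $b=f(s_2)$, the secant caustic is parameterized by the restriction of $(s,t)\mapsto f(s)-f(t)$ to the smooth curve of $(s,t)$ near $(s_1,s_2)$ with $\det(f'(s),f'(t))=0$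 (and $b-a$ is treated likewise with the roles exchanged). ''$a-b$ is an inflexion point of $\mathrm{SC}(M)$'' means that it is a regular point of this local parameterized curve at which its curvature changes sign. *)

(* Defs.v *)
From Stdlib Require Import Reals ZArith.
From Coquelicot Require Import Coquelicot.
Open Scope R_scope.

(** ** Plane vectors and parameterized plane curves *)

Definition det (v w : R * R) : R := fst v * snd w - snd v * fst w.

Definition curve_derive (n : nat) (c : R -> R * R) (u : R) : R * R :=
  (Derive_n (fun x => fst (c x)) n u, Derive_n (fun x => snd (c x)) n u).

Definition smooth_at (g : R -> R) (u : R) : Prop := forall n, ex_derive_n g n u.

Definition smooth_near (g : R -> R) (x : R) : Prop := locally x (smooth_at g).

Definition regular_at (c : R -> R * R) (u : R) : Prop :=
  curve_derive 1 c u <> (0, 0).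

(** The norm of [R * R] in Coquelicot is the Euclidean one. *)
Definition signed_curvature (c : R -> R * R) (u : R) : R :=
  det (curve_derive 1 c u) (curve_derive 2 c u) / norm (curve_derive 1 c u) ^ 3.

Definition changes_sign (g : R -> R) (x : R) : Prop :=
  (at_left x (fun u => g u < 0) /\ at_right x (fun u => 0 < g u)) \/
  (at_left x (fun u => 0 < g u) /\ at_right x (fun u => g u < 0)).

Definition same_direction (v w : R * R) : Prop :=
  exists alpha : R, 0 < alpha /\ v = scal alpha w.

(** ** Closed regular curves

    The circle is [R / 2 PI Z]: a smooth map from it to the plane is a
    [2 PI]-periodic smooth map [f : R -> R * R].  Conditions attached to a
    point of the curve are stated at a parameter [s], so that at a
    self-crossing they concern one of the branches. *)

Definition same_param (s t : R) : Prop :=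
  exists k : Z, s = t + 2 * PI * IZR k.

Definition closed_smooth_curve (f : R -> R * R) : Prop :=
  (forall s, f (s + 2 * PI) = f s) /\
  (forall s, smooth_at (fun x => fst (f x)) s /\ smooth_at (fun x => snd (f x)) s).

Definition closed_regular_curve (f : R -> R * R) : Prop :=
  closed_smooth_curve f /\ forall s, regular_at f s.

Definition parallel_at (f : R -> R * R) (s t : R) : Prop :=
  det (curve_derive 1 f s) (curve_derive 1 f t) = 0.

Definition parallel_pair (f : R -> R * R) (s t : R) : Prop :=
  f s <> f t /\ parallel_at f s t.

Definition inflexion (f : R -> R * R) (s : R) : Prop :=
  changes_sign (signed_curvature f) s.

Definition undulation (f : R -> R * R) (s : R) : Prop :=
  signed_curvature f s = 0 /\ ~ changes_sign (signed_curvature f) s.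

Definition nondegenerate (f : R -> R * R) (s : R) : Prop :=
  det (curve_derive 1 f s) (curve_derive 3 f s) <> 0.

(** [fun u => f (phi u)] is an arc length parameterization of the branch of
    [f] at [s], in either direction. *)
Definition arc_length_param (f : R -> R * R) (s : R) (phi : R -> R) : Prop :=
  phi 0 = s /\ smooth_near phi 0 /\
  locally 0 (fun u => norm (curve_derive 1 (fun x => f (phi x)) u) = 1).

Record generic (f : R -> R * R) : Prop := {
  generic_regular : closed_regular_curve f;
  generic_inflexion : forall s, inflexion f s -> nondegenerate f s;
  generic_undulation : forall s, ~ undulation f s;
  generic_crossing : forall s1 s2,
    ~ same_param s1 s2 -> f s1 = f s2 ->
    det (curve_derive 1 f s1) (curve_derive 1 f s2) <> 0;
  generic_parallel : forall s1 s2,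
    parallel_pair f s1 s2 -> ~ inflexion f s1 \/ ~ inflexion f s2;
  generic_curvature : forall s1 s2 phi1 phi2,
    ~ same_param s1 s2 -> parallel_pair f s1 s2 ->
    arc_length_param f s1 phi1 -> arc_length_param f s2 phi2 ->
    let g1 := fun u => f (phi1 u) in
    let g2 := fun u => f (phi2 u) in
    same_direction (curve_derive 1 g1 0) (curve_derive 1 g2 0) ->
    signed_curvature g1 0 = signed_curvature g2 0 ->
    Derive (signed_curvature g1) 0 <> Derive (signed_curvature g2) 0
}.

(** ** The secant caustic *)

Definition closure_of (A : R * R -> Prop) (p : R * R) : Prop :=
  forall P : R * R -> Prop, locally p P -> exists q, P q /\ A q.

Definition secant_caustic (f : R -> R * R) : R * R -> Prop :=
  closure_of (fun p => exists s t, parallel_pair f s t /\ p = minus (f s) (f t)).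

(** [u |-> (sigma u, tau u)] is a regular smooth parameterization, near
    [u = 0], of the set of all [(s, t)] near [(s1, s2)] at which the tangents
    of [f] are parallel; the last clause says that, however small the interval
    of parameters around [0], it covers a full neighbourhood of [(s1, s2)] in
    this set. *)
Definition parallel_set_param (f : R -> R * R) (s1 s2 : R) (sigma tau : R -> R)
    : Prop :=
  (sigma 0 = s1 /\ tau 0 = s2) /\
  (smooth_near sigma 0 /\ smooth_near tau 0) /\
  regular_at (fun u => (sigma u, tau u)) 0 /\
  locally 0 (fun u => parallel_at f (sigma u) (tau u)) /\
  (forall P : R -> Prop, locally 0 P ->
     locally (s1, s2) (fun p : R * R =>
       parallel_at f (fst p) (snd p) ->
       exists u, P u /\ sigma u = fst p /\ tau u = snd p)).

(** The point [f s1 - f s2] of the secant caustic is an inflexion point of the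
    local branch coming from the pair of parameters [(s1, s2)]. *)
Definition secant_caustic_inflexion (f : R -> R * R) (s1 s2 : R) : Prop :=
  secant_caustic f (minus (f s1) (f s2)) /\
  exists sigma tau : R -> R,
    parallel_set_param f s1 s2 sigma tau /\
    let c := fun u => minus (f (sigma u)) (f (tau u)) in
    regular_at c 0 /\ changes_sign (signed_curvature c) 0.

(* Main.v *)
Require Import Defs.
From Stdlib Require Import Reals Lra Ranalysis5 ClassicalEpsilon FunctionalExtensionality.
From Coquelicot Require Import Coquelicot.
Open Scope R_scope.

(** Let [u |-> (sigma u, tau u)] parameterize parallel pairs near [(s1, s2)] and
    let [c = f (sigma) - f (tau)] be the corresponding branch of the secant caustic.
    The velocity of [c] combines the parallel vectors [f' (sigma)] and [f' (tau)],
    so the tangent of the caustic is parallel to that of the curve: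
    [c' = k f' (sigma)].  Hence
    [det (c', c'') = k^2 sigma' det (f' (sigma), f'' (sigma))], and where [c] is
    regular its curvature has the sign of [sigma'] times the curvature of [f] at
    [sigma] ([difference_curve_curvature]).

    Suppose the curvature of [c] changes sign.  Then [sigma'] or the curvature of
    [f] at [s1] vanishes.  In the first case, differentiating the parallelism
    condition ([parallel_constraint]) and using that [(sigma', tau')] is not zero
    shows that the curvature of [f] vanishes at [s2]
    ([caustic_inflexion_turning]).  Since a generic curve has no undulation
    points, a zero of its curvature is an inflexion.

    Conversely let [f s1] be an inflexion point.  By genericity [f s2] is not one,
    so the curvature of [f] at [s2] is nonzero, the slope of the tangent is a
    local coordinate at [s2], and the parallel pairs near [(s1, s2)] form a graph
    [t = tau s] ([parallel_graph]).  On it [sigma' = 1], and [tau' = 0] at the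
    given pair, which makes [c] regular there; its curvature then has the sign of
    that of [f] at [sigma], which changes ([inflexion_caustic_inflexion]).  An
    inflexion at [s2] is the same situation with the two points exchanged, which
    only reflects the caustic in the origin ([secant_caustic_inflexion_sym]). *)

(** * Smooth functions on an open set *)

(** The derivatives are witnesses in a chain over one fixed set [D], which gives
    closure under products, composition and inversion by plain induction on
    the order.  Fixing [D] matters: [smooth_near] asks for one neighbourhood on
    which derivatives of all orders exist, and a chain of germs would let the
    neighbourhood shrink with the order. *)
Fixpoint ndiff (n : nat) (D : R -> Prop) (g : R -> R) : Prop :=
  match n with
  | O => True
  | S n => exists g', (forall x, D x -> is_derive g x (g' x)) /\ ndiff n D g'
  end.

Definition smooth_on (D : R -> Prop) (g : R -> R) : Prop := forall n, ndiff n D g.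

Lemma ndiff_pred n D g : ndiff (S n) D g -> ndiff n D g.
Proof.
  revert g; induction n as [|n IH]; intros g Hg; [exact I|].
  destruct Hg as [g' [Hd Hg']].
  exists g'; split; [exact Hd | now apply IH].
Qed.

Lemma ndiff_sub n (D E : R -> Prop) g :
  (forall x, E x -> D x) -> ndiff n D g -> ndiff n E g.
Proof.
  intros HDE; revert g; induction n as [|n IH]; intros g Hg; [exact I|].
  destruct Hg as [g' [Hd Hg']].
  exists g'; split; auto.
Qed.

Lemma ndiff_ex_derive_n n D g :
  open D -> ndiff n D g -> forall x, D x -> ex_derive_n g n x.
Proof.
  intros HD; revert g; induction n as [|n IH]; intros g Hg x Hx; [exact I|].
  destruct Hg as [g' [Hd Hg']].
  destruct n as [|n]; [exists (g' x); now apply Hd|].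
  assert (Hg1 : ex_derive_n (Derive g) (S n) x).
  { apply ex_derive_n_ext_loc with (f := g'); [|now apply IH].
    apply (locally_open D); trivial.
    intros y Hy; symmetry; now apply is_derive_unique, Hd. }
  apply ex_derive_ext with (f := Derive_n (Derive g) n); [|exact Hg1].
  intros y; change (Derive g) with (Derive_n g 1).
  rewrite Derive_n_comp; f_equal; apply PeanoNat.Nat.add_1_r.
Qed.

Lemma ex_derive_n_ndiff n (D : R -> Prop) g :
  (forall k x, D x -> ex_derive_n g k x) -> ndiff n D g.
Proof.
  revert g; induction n as [|n IH]; intros g Hg; [exact I|].
  exists (Derive g); split.
  - intros x Hx; apply Derive_correct; exact (Hg 1%nat x Hx).
  - apply IH; intros [|k] x Hx; [exact I|].
    apply ex_derive_ext with (f := Derive_n g (S k)); [|exact (Hg (S (S k)) x Hx)].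
    intros y; change (Derive g) with (Derive_n g 1).
    rewrite Derive_n_comp; f_equal; symmetry; apply PeanoNat.Nat.add_1_r.
Qed.

Lemma smooth_on_near (D : R -> Prop) g x : open D -> D x -> smooth_on D g -> smooth_near g x.
Proof.
  intros HD Hx Hg; apply (locally_open D); trivial.
  intros y Hy n; now apply (ndiff_ex_derive_n n D).
Qed.

Lemma smooth_near_on g x :
  smooth_near g x -> exists D, open D /\ D x /\ smooth_on D g.
Proof.
  intros Hg; exists (fun y => locally y (smooth_at g)); split; [|split].
  - intros y Hy; now apply locally_locally.
  - exact Hg.
  - intros n; apply ex_derive_n_ndiff; intros k y Hy.
    exact (locally_singleton _ _ Hy k).
Qed.

Lemma smooth_on_sub (D E : R -> Prop) g :
  (forall x, E x -> D x) -> smooth_on D g -> smooth_on E g.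
Proof. intros HDE Hg n; now apply (ndiff_sub n D). Qed.

Lemma ndiff_ext n D f g : (forall x, f x = g x) -> ndiff n D f -> ndiff n D g.
Proof.
  intros Hfg; destruct n as [|n]; [trivial|].
  intros [f' [Df Hf]]; exists f'; split; trivial.
  intros x Hx; apply (is_derive_ext f); auto.
Qed.

Lemma ndiff_const n D a : ndiff n D (fun _ => a).
Proof.
  revert a; induction n as [|n IH]; intros a; [exact I|].
  exists (fun _ => 0); split; [intros x _; apply @is_derive_const | apply IH].
Qed.

Lemma ndiff_id n D : ndiff n D (fun x => x).
Proof.
  destruct n as [|n]; [exact I|].
  exists (fun _ => 1); split; [intros x _; apply @is_derive_id | apply ndiff_const].
Qed.

Lemma ndiff_plus n D f g :
  ndiff n D f -> ndiff n D g -> ndiff n D (fun x => f x + g x).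
Proof.
  revert f g; induction n as [|n IH]; intros f g Hf Hg; [exact I|].
  destruct Hf as [f' [Df Hf]], Hg as [g' [Dg Hg]].
  exists (fun x => f' x + g' x); split; [|now apply IH].
  intros x Hx; apply @is_derive_plus; auto.
Qed.

Lemma ndiff_mult n D f g :
  ndiff n D f -> ndiff n D g -> ndiff n D (fun x => f x * g x).
Proof.
  revert f g; induction n as [|n IH]; intros f g Hf Hg; [exact I|].
  pose proof (ndiff_pred _ _ _ Hf) as Hf0; pose proof (ndiff_pred _ _ _ Hg) as Hg0.
  destruct Hf as [f' [Df Hf]], Hg as [g' [Dg Hg]].
  exists (fun x => f' x * g x + f x * g' x); split.
  - intros x Hx; apply Derive.is_derive_mult; auto.
  - apply ndiff_plus; now apply IH.
Qed.

Lemma ndiff_inv n (D : R -> Prop) g :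
  (forall x, D x -> g x <> 0) -> ndiff n D g -> ndiff n D (fun x => / g x).
Proof.
  intros Hg0; induction n as [|n IH]; intros Hg; [exact I|].
  pose proof (IH (ndiff_pred _ _ _ Hg)) as Hi.
  destruct Hg as [g' [Dg Hg]].
  exists (fun x => -1 * g' x * (/ g x * / g x)); split.
  - intros x Hx.
    replace (-1 * g' x * (/ g x * / g x)) with (- g' x / g x ^ 2)
      by (field; now apply Hg0).
    apply is_derive_inv; auto.
  - apply ndiff_mult; [apply ndiff_mult; trivial; apply ndiff_const|].
    now apply ndiff_mult.
Qed.

Lemma ndiff_comp n (D E : R -> Prop) f g :
  (forall x, E x -> D (g x)) ->
  ndiff n D f -> ndiff n E g -> ndiff n E (fun x => f (g x)).
Proof.
  intros HDE; revert f; induction n as [|n IH]; intros f Hf Hg; [exact I|].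
  pose proof (ndiff_pred _ _ _ Hg) as Hg0.
  destruct Hf as [f' [Df Hf]], Hg as [g' [Dg Hg]].
  exists (fun x => g' x * f' (g x)); split.
  - intros x Hx; apply (is_derive_comp f g); auto.
  - apply ndiff_mult; auto.
Qed.

(** Bootstrapping: the equation [h' = 1 / m'(h)] returns one more order of
    differentiability of [h] than is put in. *)
Lemma smooth_on_reciprocal (D E : R -> Prop) m m' h :
  (forall t, D t -> is_derive m t (m' t)) -> smooth_on D m' ->
  (forall y, E y -> D (h y)) -> (forall t, D t -> m' t <> 0) ->
  (forall y, E y -> is_derive h y (/ m' (h y))) -> smooth_on E h.
Proof.
  intros Dm Sm HED Hm0 Dh n; induction n as [|n IH]; [exact I|].
  exists (fun y => / m' (h y)); split; [exact Dh|].
  apply ndiff_inv; [auto|].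
  now apply (ndiff_comp n D).
Qed.

Lemma smooth_on_derive (D : R -> Prop) g :
  open D -> smooth_on D g ->
  (forall x, D x -> is_derive g x (Derive g x)) /\ smooth_on D (Derive g).
Proof.
  intros HD Hg; split.
  - intros x Hx; apply Derive_correct.
    exact (ndiff_ex_derive_n 1 D g HD (Hg 1%nat) x Hx).
  - intros n; apply ex_derive_n_ndiff; intros [|k] x Hx; [exact I|].
    apply ex_derive_ext with (f := Derive_n g (S k)).
    + intros y; change (Derive g) with (Derive_n g 1).
      rewrite Derive_n_comp; f_equal; symmetry; apply PeanoNat.Nat.add_1_r.
    + exact (ndiff_ex_derive_n (S (S k)) D g HD (Hg _) x Hx).
Qed.

(** * Smooth local inverses on the line *)

Lemma open_Ioo a b : open (fun t : R => a < t < b).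
Proof.
  apply (open_and (fun t => a < t) (fun t => t < b)); [apply open_gt | apply open_lt].
Qed.

Lemma locally_segment (P : R -> Prop) x :
  locally x P -> exists a b, a < x < b /\ forall t, a <= t <= b -> P t.
Proof.
  intros [e He]; exists (x - e / 2), (x + e / 2).
  pose proof (cond_pos e); split; [lra|].
  intros t Ht; apply He; change (Rabs (t - x) < e).
  apply Rabs_def1; lra.
Qed.

(** Near [t0] the derivative stays positive, so [m] is strictly increasing on a
    segment, its inverse [h] exists there by the intermediate value theorem, and
    [h] inherits all derivatives through [h' = 1 / m'(h)]. *)
Lemma local_inverse_increasing (D : R -> Prop) m t0 :
  open D -> D t0 -> smooth_on D m -> 0 < Derive m t0 ->
  exists (E : R -> Prop) h,
    open E /\ E (m t0) /\ smooth_on E h /\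
    (forall y, E y -> D (h y) /\ m (h y) = y) /\ locally t0 (fun t => h (m t) = t).
Proof.
  intros HD Ht0 Sm Hpos.
  destruct (smooth_on_derive D m HD Sm) as [Dm Sm'].
  assert (Hloc : locally t0 (fun t => D t /\ 0 < Derive m t)).
  { apply filter_and; [now apply HD|].
    destruct (smooth_on_derive D (Derive m) HD Sm') as [Dm' _].
    apply (ex_derive_continuous (Derive m) t0 (ex_intro _ _ (Dm' t0 Ht0))).
    now apply open_gt. }
  destruct (locally_segment _ _ Hloc) as [a [b [Hab HP]]].
  assert (Hinc : forall x y, a <= x -> x < y -> y <= b -> m x < m y).
  { intros x y Hx Hxy Hy.
    destruct (MVT_gen m x y (Derive m)) as [c [Hc Heq]].
    - intros z; rewrite Rmin_left, Rmax_right by lra; intros Hz; apply Dm, HP; lra.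
    - intros z; rewrite Rmin_left, Rmax_right by lra; intros Hz.
      apply continuity_pt_filterlim.
      apply (ex_derive_continuous m z); exists (Derive m z); apply Dm, HP; lra.
    - rewrite Rmin_left, Rmax_right in Hc by lra.
      assert (0 < Derive m c) by (apply HP; lra).
      assert (0 < Derive m c * (y - x)) by (apply Rmult_lt_0_compat; lra).
      lra. }
  assert (Hinj : forall x y, a <= x <= b -> a <= y <= b -> m x = m y -> x = y).
  { intros x y Hx Hy Hxy; destruct (Rtotal_order x y) as [H|[H|H]]; trivial.
    - pose proof (Hinc x y ltac:(lra) H ltac:(lra)); lra.
    - pose proof (Hinc y x ltac:(lra) H ltac:(lra)); lra. }
  assert (Hcont : forall z, a <= z <= b -> continuity_pt m z).
  { intros z Hz; apply continuity_pt_filterlim.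
    apply (ex_derive_continuous m z); exists (Derive m z); now apply Dm, HP. }
  assert (Hsurj : forall y, exists t, m a <= y <= m b -> a <= t <= b /\ m t = y).
  { intros y.
    destruct (excluded_middle_informative (m a <= y <= m b)) as [Hy|Hy];
      [|exists a; intros; contradiction].
    destruct (f_interv_is_interv m a b y ltac:(lra) Hy Hcont) as [t [Ht Hty]].
    exists t; split; trivial. }
  destruct (choice _ Hsurj) as [h Hh].
  assert (Hhm : forall t, a <= t <= b -> h (m t) = t).
  { intros t Ht.
    assert (Hy : m a <= m t <= m b).
    { split.
      - destruct (Req_dec a t) as [->|]; [lra|left; apply Hinc; lra].
      - destruct (Req_dec t b) as [->|]; [lra|left; apply Hinc; lra]. }
    destruct (Hh (m t) Hy) as [H1 H2]; now apply Hinj. }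
  assert (Hstrict : forall y, m a < y < m b -> a < h y < b).
  { intros y Hy; destruct (Hh y ltac:(lra)) as [H1 H2]; split.
    - destruct (Req_dec a (h y)) as [E|]; [rewrite <- E in H2; lra|lra].
    - destruct (Req_dec b (h y)) as [E|]; [rewrite <- E in H2; lra|lra]. }
  assert (Hlr : m a < m b) by (apply Hinc; lra).
  assert (Dh : forall y, m a < y < m b -> is_derive h y (/ Derive m (h y))).
  { intros y Hy; apply is_derive_Reals.
    assert (Hg : continuity_pt h y).
    { apply (continuity_pt_recip_interv m h a b ltac:(lra)); trivial;
        intros x Hx1 Hx2; now apply Hh. }
    assert (Prf : forall t, h (m a) <= t <= h (m b) -> derivable_pt m t).
    { intros t; rewrite !Hhm by lra; intros Ht.
      exists (Derive m t); apply is_derive_Reals, Dm, HP; lra. }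
    assert (Hin : h (m a) <= h y <= h (m b)).
    { rewrite !Hhm by lra; apply Hh; lra. }
    assert (Hder : derive_pt m (h y) (Prf (h y) Hin) = Derive m (h y)).
    { apply derive_pt_eq_0, is_derive_Reals, Dm, HP; apply Hh; lra. }
    rewrite <- Rdiv_1_l, <- Hder.
    apply (derivable_pt_lim_recip_interv m h (m a) (m b)); trivial.
    - intros x Hx; now apply Hh.
    - rewrite Hder; apply Rgt_not_eq, HP, Hh; lra. }
  exists (fun y => m a < y < m b), h; repeat split.
  - apply open_Ioo.
  - apply Hinc; lra.
  - apply Hinc; lra.
  - apply (smooth_on_reciprocal (fun t => a < t < b) _ m (Derive m)); trivial.
    + intros t Ht; apply Dm, HP; lra.
    + apply (smooth_on_sub D); trivial; intros t Ht; apply HP; lra.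
    + intros t Ht; apply Rgt_not_eq, HP; lra.
  - apply HP, Hh; lra.
  - apply Hh; lra.
  - apply (locally_open (fun t => a < t < b)); trivial; [apply open_Ioo|].
    intros t Ht; apply Hhm; lra.
Qed.

(** Scaling [m] by its own derivative at [t0] makes that derivative a square,
    which reduces both signs to the increasing case. *)
Lemma local_inverse (D : R -> Prop) m t0 :
  open D -> D t0 -> smooth_on D m -> Derive m t0 <> 0 ->
  exists (E : R -> Prop) h,
    open E /\ E (m t0) /\ smooth_on E h /\
    (forall y, E y -> D (h y) /\ m (h y) = y) /\ locally t0 (fun t => h (m t) = t).
Proof.
  intros HD Ht0 Sm Hne.
  set (l := Derive m t0) in *.
  destruct (local_inverse_increasing D (fun t => l * m t) t0)
    as [E [h [HE [Et0 [Sh [Hmh Hhm]]]]]]; trivial.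
  - intros n; apply ndiff_mult; [apply ndiff_const | apply Sm].
  - rewrite Derive_scal; fold l.
    now apply Rlt_0_sqr.
  - exists (fun y => E (l * y)), (fun y => h (l * y)); repeat split; trivial.
    + apply (open_comp (fun y => l * y) E); trivial.
      intros y _; apply (ex_derive_continuous (fun z => l * z)); auto_derive; trivial.
    + intros n; apply (ndiff_comp n E _ h (fun y => l * y)); [trivial|apply Sh|].
      apply ndiff_mult; [apply ndiff_const | apply ndiff_id].
    + now apply Hmh.
    + apply Rmult_eq_reg_l with l; trivial; now apply Hmh.
Qed.

(** * Sign changes *)

Definition same_sign (a b : R) : Prop := (0 < a <-> 0 < b) /\ (a < 0 <-> b < 0).

Lemma same_sign_sym a b : same_sign a b -> same_sign b a.
Proof. unfold same_sign; tauto. Qed.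

Lemma same_sign_trans a b c : same_sign a b -> same_sign b c -> same_sign a c.
Proof. unfold same_sign; tauto. Qed.

Lemma same_sign_scale k a : 0 < k -> same_sign (k * a) a.
Proof. intros Hk; split; split; intros H; nra. Qed.

Lemma changes_sign_ext g h x :
  locally x (fun u => same_sign (g u) (h u)) -> changes_sign g x -> changes_sign h x.
Proof.
  intros Hs Hg.
  assert (T : forall P Q D : R -> Prop,
    (forall u, same_sign (g u) (h u) -> P u -> Q u) ->
    within D (locally x) P -> within D (locally x) Q).
  { intros P Q D HPQ HP; unfold within.
    generalize (filter_and _ _ Hs HP); apply filter_imp; intuition. }
  destruct Hg as [[Hl Hr]|[Hl Hr]]; [left|right]; split;
    (eapply T; [|first [exact Hl|exact Hr]]); unfold same_sign; tauto.
Qed.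

Lemma changes_sign_zero (g : R -> R) (x : R) : continuous g x -> changes_sign g x -> g x = 0.
Proof.
  intros Hc Hg.
  assert (Tl : forall P Q : R -> Prop,
    locally x P -> at_left x Q -> exists u, P u /\ Q u).
  { intros P Q HP HQ; apply (filter_ex (F := at_left x)).
    apply filter_and; [now apply filter_le_within | exact HQ]. }
  assert (Tr : forall P Q : R -> Prop,
    locally x P -> at_right x Q -> exists u, P u /\ Q u).
  { intros P Q HP HQ; apply (filter_ex (F := at_right x)).
    apply filter_and; [now apply filter_le_within | exact HQ]. }
  destruct (Rtotal_order (g x) 0) as [H|[H|H]]; trivial; exfalso.
  - assert (HP : locally x (fun u => g u < 0)).
    { apply (Hc (fun z => z < 0)); now apply open_lt. }
    destruct Hg as [[Hl Hr]|[Hl Hr]];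
      [destruct (Tr _ _ HP Hr) as [u Hu]|destruct (Tl _ _ HP Hl) as [u Hu]]; lra.
  - assert (HP : locally x (fun u => 0 < g u)).
    { apply (Hc (fun z => 0 < z)); now apply open_gt. }
    destruct Hg as [[Hl Hr]|[Hl Hr]];
      [destruct (Tl _ _ HP Hl) as [u Hu]|destruct (Tr _ _ HP Hr) as [u Hu]]; lra.
Qed.

Lemma locally_shift (P : R -> Prop) (s : R) :
  locally s P <-> locally 0 (fun u => P (s + u)).
Proof.
  split; intros [e He]; exists e; intros y Hy.
  - change (Rabs (y - 0) < e) in Hy; apply He; change (Rabs (s + y - s) < e).
    now replace (s + y - s) with (y - 0) by ring.
  - change (Rabs (y - s) < e) in Hy.
    replace y with (s + (y - s)) by ring; apply He.
    change (Rabs (y - s - 0) < e); now rewrite Rminus_0_r.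
Qed.

Lemma changes_sign_shift g s :
  changes_sign g s -> changes_sign (fun u => g (s + u)) 0.
Proof.
  assert (Tl : forall P : R -> Prop, at_left s P -> at_left 0 (fun u => P (s + u))).
  { intros P HP; generalize (proj1 (locally_shift _ s) HP); unfold at_left, at_right, within.
    apply filter_imp; intros u H Hu; apply H; lra. }
  assert (Tr : forall P : R -> Prop, at_right s P -> at_right 0 (fun u => P (s + u))).
  { intros P HP; generalize (proj1 (locally_shift _ s) HP); unfold at_left, at_right, within.
    apply filter_imp; intros u H Hu; apply H; lra. }
  intros [[Hl Hr]|[Hl Hr]]; [left|right]; split;
    first [now apply (Tl (fun u => g u < 0)) | now apply (Tl (fun u => 0 < g u))
          |now apply (Tr (fun u => g u < 0)) | now apply (Tr (fun u => 0 < g u))].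
Qed.

(** * Plane vectors and velocities of plane curves *)

(** The numerator of the signed curvature: it has the same sign and, unlike
    the curvature, is a polynomial in the derivatives of the curve. *)
Definition turning (c : R -> R * R) (u : R) : R :=
  det (curve_derive 1 c u) (curve_derive 2 c u).

(** At a regular parameter the two differ by the positive factor [norm ^ 3]; at a
    singular one the numerator vanishes, and with it the quotient. *)
Lemma signed_curvature_sign c u : same_sign (signed_curvature c u) (turning c u).
Proof.
  unfold signed_curvature; fold (turning c u).
  destruct (excluded_middle_informative (curve_derive 1 c u = (0, 0))) as [E|E].
  - assert (turning c u = 0) as ->.
    { unfold turning, det; rewrite E; simpl; ring. }
    unfold Rdiv; rewrite Rmult_0_l; split; reflexivity.
  - unfold Rdiv; rewrite Rmult_comm; apply same_sign_scale.
    apply Rinv_0_lt_compat, pow_lt, norm_gt_0; exact E.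
Qed.

Lemma det_scal_l k a b : det (scal k a) b = k * det a b.
Proof. unfold det; simpl; unfold scal; simpl; unfold mult; simpl; ring. Qed.

Lemma det_scal_r k a b : det a (scal k b) = k * det a b.
Proof. unfold det; simpl; unfold scal; simpl; unfold mult; simpl; ring. Qed.

Lemma det_minus_l a b v : det (minus a b) v = det a v - det b v.
Proof. unfold det, minus; simpl; unfold plus, opp; simpl; ring. Qed.

Lemma det_antisym a b : det a b = - det b a.
Proof. unfold det; ring. Qed.

Lemma det_diag a : det a a = 0.
Proof. unfold det; ring. Qed.

(** The coefficient is the orthogonal projection [<a, b> / <a, a>]. *)
Lemma det_parallel a b : a <> (0, 0) -> det a b = 0 -> exists k, b = scal k a.
Proof.
  destruct a as [a1 a2], b as [b1 b2]; unfold det; simpl; intros Ha Hd.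
  assert (Hn : a1 * a1 + a2 * a2 <> 0).
  { intros E; apply Ha; f_equal; nra. }
  exists ((a1 * b1 + a2 * b2) / (a1 * a1 + a2 * a2)).
  unfold scal; simpl; unfold prod_scal, scal; simpl; unfold mult; simpl.
  f_equal; apply Rmult_eq_reg_r with (a1 * a1 + a2 * a2); trivial.
  - transitivity ((a1 * b1 + a2 * b2) * a1 - a2 * (a1 * b2 - a2 * b1));
      [ring | rewrite Hd; now field].
  - transitivity ((a1 * b1 + a2 * b2) * a2 + a1 * (a1 * b2 - a2 * b1));
      [ring | rewrite Hd; now field].
Qed.


Definition smooth_curve_on (D : R -> Prop) (c : R -> R * R) : Prop :=
  smooth_on D (fun u => fst (c u)) /\ smooth_on D (fun u => snd (c u)).

Definition is_velocity (c : R -> R * R) (u : R) (v : R * R) : Prop :=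
  is_derive (fun x => fst (c x)) u (fst v) /\ is_derive (fun x => snd (c x)) u (snd v).

Lemma smooth_on_Derive_n D g n u :
  open D -> smooth_on D g -> D u -> is_derive (Derive_n g n) u (Derive_n g (S n) u).
Proof.
  intros HD Hg Hu; apply Derive_correct.
  exact (ndiff_ex_derive_n (S n) D g HD (Hg _) u Hu).
Qed.

Lemma is_velocity_curve_derive D c n u :
  open D -> smooth_curve_on D c -> D u ->
  is_velocity (curve_derive n c) u (curve_derive (S n) c u).
Proof.
  intros HD [H1 H2] Hu; split; now apply (smooth_on_Derive_n D).
Qed.

Lemma is_velocity_unique c u v : is_velocity c u v -> curve_derive 1 c u = v.
Proof.
  intros [H1 H2]; destruct v as [v1 v2].
  unfold curve_derive; f_equal; now apply is_derive_unique.
Qed.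

Lemma is_velocity_comp c phi u v l :
  is_velocity c (phi u) v -> is_derive phi u l ->
  is_velocity (fun x => c (phi x)) u (scal l v).
Proof.
  intros [H1 H2] Hp; split.
  - exact (is_derive_comp (fun x => fst (c x)) phi u _ l H1 Hp).
  - exact (is_derive_comp (fun x => snd (c x)) phi u _ l H2 Hp).
Qed.

Lemma is_velocity_minus a b u v w :
  is_velocity a u v -> is_velocity b u w ->
  is_velocity (fun x => minus (a x) (b x)) u (minus v w).
Proof.
  intros [H1 H2] [H3 H4]; split.
  - exact (is_derive_minus _ _ u _ _ H1 H3).
  - exact (is_derive_minus _ _ u _ _ H2 H4).
Qed.

Lemma is_derive_det a b u v w :
  is_velocity a u v -> is_velocity b u w ->
  is_derive (fun x => det (a x) (b x)) u (det v (b u) + det (a u) w).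
Proof.
  intros [H1 H2] [H3 H4]; unfold det.
  replace (_ + _) with
    ((fst v * snd (b u) + fst (a u) * snd w) - (snd v * fst (b u) + snd (a u) * fst w))
    by ring.
  apply (is_derive_minus (fun x => fst (a x) * snd (b x)) (fun x => snd (a x) * fst (b x)));
    now apply Derive.is_derive_mult.
Qed.

Lemma is_derive_locally_zero (g : R -> R) u l :
  locally u (fun x => g x = 0) -> is_derive g u l -> l = 0.
Proof.
  intros Hz Hg; rewrite <- (is_derive_unique _ _ _ Hg).
  rewrite (Derive_ext_loc g (fun _ => 0)); [apply Derive_const | exact Hz].
Qed.

Lemma closed_curve_smooth f : closed_regular_curve f -> smooth_curve_on (fun _ => True) f.
Proof.
  intros [[_ Hs] _]; split; intros n; apply ex_derive_n_ndiff;
    intros k x _; now apply Hs.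
Qed.

Lemma is_velocity_closed f n s :
  closed_regular_curve f ->
  is_velocity (curve_derive n f) s (curve_derive (S n) f s).
Proof.
  intros Hf; apply (is_velocity_curve_derive (fun _ => True)); trivial.
  - apply open_true.
  - now apply closed_curve_smooth.
Qed.

(** * Curvature of a branch of the secant caustic *)

(** The derivative of [det (f' (sigma), f' (tau)) = 0] along the branch. *)
Lemma parallel_constraint f (E : R -> Prop) sigma tau u :
  closed_regular_curve f -> open E ->
  smooth_on E sigma -> smooth_on E tau ->
  (forall x, E x -> parallel_at f (sigma x) (tau x)) -> E u ->
  Derive sigma u * det (curve_derive 2 f (sigma u)) (curve_derive 1 f (tau u)) +
  Derive tau u * det (curve_derive 1 f (sigma u)) (curve_derive 2 f (tau u)) = 0.
Proof.
  intros Hf HE Hs Ht Hpar Hu.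
  pose proof (proj1 (smooth_on_derive E sigma HE Hs) u Hu) as Ds.
  pose proof (proj1 (smooth_on_derive E tau HE Ht) u Hu) as Dt.
  pose proof (is_velocity_comp _ sigma u _ _ (is_velocity_closed f 1 (sigma u) Hf) Ds) as Vs.
  pose proof (is_velocity_comp _ tau u _ _ (is_velocity_closed f 1 (tau u) Hf) Dt) as Vt.
  rewrite <- (is_derive_locally_zero _ _ _ (locally_open E _ HE Hpar u Hu)
                (is_derive_det _ _ _ _ _ Vs Vt)).
  rewrite !det_scal_l, !det_scal_r; ring.
Qed.

Definition difference_curve (f : R -> R * R) (sigma tau : R -> R) (u : R) : R * R :=
  minus (f (sigma u)) (f (tau u)).

Lemma difference_curve_smooth f (E : R -> Prop) sigma tau :
  closed_regular_curve f -> smooth_on E sigma -> smooth_on E tau ->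
  smooth_curve_on E (difference_curve f sigma tau).
Proof.
  intros Hf Hs Ht.
  assert (T : forall g, smooth_on (fun _ => True) g ->
    smooth_on E (fun u => g (sigma u) + -1 * g (tau u))).
  { intros g Hg n; apply ndiff_plus.
    - now apply (ndiff_comp n (fun _ => True)).
    - apply ndiff_mult; [apply ndiff_const|].
      now apply (ndiff_comp n (fun _ => True)). }
  destruct (closed_curve_smooth f Hf) as [H1 H2]; split; intros n.
  - refine (ndiff_ext n E _ _ _ (T _ H1 n)); intros u.
    unfold difference_curve, minus; simpl; unfold plus, opp; simpl; ring.
  - refine (ndiff_ext n E _ _ _ (T _ H2 n)); intros u.
    unfold difference_curve, minus; simpl; unfold plus, opp; simpl; ring.
Qed.

Lemma difference_curve_velocity f (E : R -> Prop) sigma tau u :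
  closed_regular_curve f -> open E -> smooth_on E sigma -> smooth_on E tau -> E u ->
  curve_derive 1 (difference_curve f sigma tau) u =
  minus (scal (Derive sigma u) (curve_derive 1 f (sigma u)))
        (scal (Derive tau u) (curve_derive 1 f (tau u))).
Proof.
  intros Hf HE Hs Ht Hu; apply is_velocity_unique.
  apply (is_velocity_minus (fun x => f (sigma x)) (fun x => f (tau x)));
    apply is_velocity_comp.
  - exact (is_velocity_closed f 0 _ Hf).
  - exact (proj1 (smooth_on_derive E sigma HE Hs) u Hu).
  - exact (is_velocity_closed f 0 _ Hf).
  - exact (proj1 (smooth_on_derive E tau HE Ht) u Hu).
Qed.

(** The velocity of [c = f (sigma) - f (tau)] is [sigma' f' (sigma) - tau' f' (tau)],
    a combination of two parallel vectors, so [c' = k f' (sigma)] for some scalar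
    [k], nonzero when [c] is regular.  Differentiating [det (c', f' (sigma)) = 0]
    gives [det (c'', f' (sigma)) = - sigma' det (c', f'' (sigma))], whence
    [det (c', c'') = k^2 sigma' det (f' (sigma), f'' (sigma))]. *)
Lemma difference_curve_curvature f (E : R -> Prop) sigma tau u :
  closed_regular_curve f -> open E ->
  smooth_on E sigma -> smooth_on E tau ->
  (forall x, E x -> parallel_at f (sigma x) (tau x)) -> E u ->
  regular_at (difference_curve f sigma tau) u ->
  same_sign (signed_curvature (difference_curve f sigma tau) u)
            (Derive sigma u * turning f (sigma u)).
Proof.
  intros Hf HE Hs Ht Hpar Hu Hreg.
  set (c := difference_curve f sigma tau) in *.
  apply same_sign_trans with (turning c u); [apply signed_curvature_sign|].
  assert (Htan : forall x, E x -> det (curve_derive 1 c x) (curve_derive 1 f (sigma x)) = 0).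
  { intros x Hx; unfold c; rewrite (difference_curve_velocity f E) by trivial.
    rewrite det_minus_l, !det_scal_l, det_diag, det_antisym.
    rewrite (Hpar x Hx : det _ _ = 0); ring. }
  pose proof (is_velocity_curve_derive E c 1 u HE
                (difference_curve_smooth f E _ _ Hf Hs Ht) Hu) as Vc.
  pose proof (is_velocity_comp _ sigma u _ _ (is_velocity_closed f 1 (sigma u) Hf)
                (proj1 (smooth_on_derive E sigma HE Hs) u Hu)) as Vs.
  pose proof (is_derive_locally_zero _ _ _ (locally_open E _ HE Htan u Hu)
                (is_derive_det _ _ _ _ _ Vc Vs)) as Hz.
  destruct (det_parallel (curve_derive 1 f (sigma u)) (curve_derive 1 c u)) as [k Hk].
  - apply Hf.
  - rewrite det_antisym, Htan; trivial; ring.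
  - assert (Hk0 : k <> 0).
    { intros ->; apply Hreg; rewrite Hk; exact (scal_zero_l _). }
    assert (Eq : turning c u = k ^ 2 * (Derive sigma u * turning f (sigma u))).
    { rewrite Hk, det_scal_l, det_scal_r in Hz; fold (turning f (sigma u)) in Hz.
      rewrite (det_antisym (curve_derive 2 c u)) in Hz.
      unfold turning at 1; rewrite Hk, det_scal_l; nra. }
    rewrite Eq; apply same_sign_scale.
    now apply pow2_gt_0.
Qed.

Lemma regular_near D c x :
  open D -> smooth_curve_on D c -> D x -> regular_at c x -> locally x (regular_at c).
Proof.
  intros HD Hc Hx Hreg.
  destruct (is_velocity_curve_derive D c 1 x HD Hc Hx) as [V1 V2].
  assert (T : forall g : R -> R, ex_derive g x -> g x <> 0 ->
    locally x (fun u => g u <> 0)).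
  { intros g Hg Hg0; apply (ex_derive_continuous g x Hg (fun z => z <> 0)).
    now apply open_neq. }
  destruct (excluded_middle_informative (fst (curve_derive 1 c x) = 0)) as [E1|E1];
    [destruct (excluded_middle_informative (snd (curve_derive 1 c x) = 0)) as [E2|E2]|].
  - exfalso; apply Hreg; rewrite (surjective_pairing (curve_derive 1 c x)), E1, E2; trivial.
  - generalize (T _ (ex_intro _ _ V2) E2); apply filter_imp.
    intros u Hu H; apply Hu; now rewrite H.
  - generalize (T _ (ex_intro _ _ V1) E1); apply filter_imp.
    intros u Hu H; apply Hu; now rewrite H.
Qed.

Lemma ex_derive_turning f s : closed_regular_curve f -> ex_derive (turning f) s.
Proof.
  intros Hf; eexists.
  apply (is_derive_det (curve_derive 1 f) (curve_derive 2 f));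
    now apply is_velocity_closed.
Qed.

Lemma inflexion_turning_zero f s :
  closed_regular_curve f -> inflexion f s -> turning f s = 0.
Proof.
  intros Hf Hi; apply changes_sign_zero.
  - now apply (ex_derive_continuous (turning f)), ex_derive_turning.
  - revert Hi; apply changes_sign_ext, filter_forall.
    intros u; apply signed_curvature_sign.
Qed.

Lemma turning_zero_inflexion f s : generic f -> turning f s = 0 -> inflexion f s.
Proof.
  intros Hg H0; apply NNPP; intros Hn; apply (generic_undulation f Hg s).
  split; trivial; unfold signed_curvature; fold (turning f s).
  rewrite H0; apply Rmult_0_l.
Qed.

Lemma difference_curve_changes_sign f (E : R -> Prop) sigma tau x :
  closed_regular_curve f -> open E -> E x ->
  smooth_on E sigma -> smooth_on E tau ->
  (forall u, E u -> parallel_at f (sigma u) (tau u)) ->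
  regular_at (difference_curve f sigma tau) x ->
  changes_sign (signed_curvature (difference_curve f sigma tau)) x <->
  changes_sign (fun u => Derive sigma u * turning f (sigma u)) x.
Proof.
  intros Hf HE Hx Hs Ht Hpar Hreg.
  assert (Hloc : locally x (fun u =>
    same_sign (signed_curvature (difference_curve f sigma tau) u)
              (Derive sigma u * turning f (sigma u)))).
  { generalize (filter_and _ _ (HE x Hx)
      (regular_near E _ x HE (difference_curve_smooth f E _ _ Hf Hs Ht) Hx Hreg)).
    apply filter_imp; intros u [Hu Hr].
    now apply (difference_curve_curvature f E). }
  split; apply changes_sign_ext; trivial.
  revert Hloc; apply filter_imp; intros u; apply same_sign_sym.
Qed.

Lemma parallel_at_sym f s t : parallel_at f s t -> parallel_at f t s.
Proof. unfold parallel_at; intros H; rewrite det_antisym, H; apply Ropp_0. Qed.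

(** If [sigma'] vanished, the differentiated parallelism condition would reduce to
    [tau' det (f' (sigma), f'' (tau)) = 0], and a nonzero curvature at [tau] would
    make [tau'] vanish too. *)
Lemma param_velocity_nonzero f (E : R -> Prop) sigma tau u :
  closed_regular_curve f -> open E ->
  smooth_on E sigma -> smooth_on E tau ->
  (forall x, E x -> parallel_at f (sigma x) (tau x)) -> E u ->
  regular_at (fun x => (sigma x, tau x)) u ->
  turning f (tau u) <> 0 -> Derive sigma u <> 0.
Proof.
  intros Hf HE Hs Ht Hpar Hu Hreg Hk H0; apply Hk.
  pose proof (parallel_constraint f E sigma tau u Hf HE Hs Ht Hpar Hu) as Hc.
  destruct (det_parallel (curve_derive 1 f (tau u)) (curve_derive 1 f (sigma u)))
    as [k Hkk].
  - apply Hf.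
  - now apply parallel_at_sym, Hpar.
  - rewrite H0, Hkk, det_scal_l in Hc; fold (turning f (tau u)) in Hc.
    destruct (Rmult_integral (Derive tau u * k) (turning f (tau u))) as [H|H]; trivial.
    + rewrite <- Hc; ring.
    + exfalso; destruct (Rmult_integral _ _ H) as [Ht0|Hk0].
      * apply Hreg; unfold curve_derive; f_equal; assumption.
      * apply (proj2 Hf (sigma u)); rewrite Hkk, Hk0; exact (scal_zero_l _).
Qed.

(** * Inflexions of the caustic come from inflexions of the curve *)

(** A sign change of the curvature of the branch is one of
    [sigma' det (f' (sigma), f'' (sigma))], which is continuous and so vanishes:
    either the curvature of [f] is zero at [s1], or [sigma'] is zero and then the
    curvature of [f] is zero at [s2]. *)
Lemma caustic_inflexion_turning f s1 s2 :
  closed_regular_curve f -> secant_caustic_inflexion f s1 s2 ->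
  turning f s1 = 0 \/ turning f s2 = 0.
Proof.
  intros Hf [_ [sigma [tau [[[Es Et] [[Ss St] [Hreg [Hpar _]]]] [Hc Hcs]]]]].
  destruct (smooth_near_on _ _ Ss) as [E1 [O1 [I1 S1]]].
  destruct (smooth_near_on _ _ St) as [E2 [O2 [I2 S2]]].
  (* One open set on which both coordinates are smooth and all pairs parallel. *)
  set (E := fun u => E1 u /\ E2 u /\ locally u (fun x => parallel_at f (sigma x) (tau x))).
  assert (HE : open E).
  { apply open_and; trivial; apply open_and; trivial.
    intros u Hu; now apply locally_locally. }
  assert (H0 : E 0) by (repeat split; trivial).
  assert (Hs : smooth_on E sigma).
  { apply (smooth_on_sub E1); trivial; intros x Hx; apply Hx. }
  assert (Ht : smooth_on E tau).
  { apply (smooth_on_sub E2); trivial; intros x Hx; apply Hx. }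
  assert (Hp : forall u, E u -> parallel_at f (sigma u) (tau u)).
  { intros u Hu; exact (locally_singleton _ _ (proj2 (proj2 Hu))). }
  apply (difference_curve_changes_sign f E sigma tau 0) in Hcs; trivial.
  apply changes_sign_zero in Hcs.
  - rewrite <- Et, <- Es; destruct (Rmult_integral _ _ Hcs) as [H|H]; [|now left].
    right; apply NNPP; intros Hk.
    now apply (param_velocity_nonzero f E sigma tau 0).
  - apply (ex_derive_continuous (fun u => Derive sigma u * turning f (sigma u))).
    destruct (smooth_on_derive E sigma HE Hs) as [D1 S1'].
    destruct (smooth_on_derive E (Derive sigma) HE S1') as [D2 _].
    apply (ex_derive_mult (Derive sigma) (fun u => turning f (sigma u))).
    + exists (Derive (Derive sigma) 0); now apply D2.
    + apply (ex_derive_comp (turning f) sigma); [now apply ex_derive_turning|].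
      exists (Derive sigma 0); now apply D1.
Qed.

(** * The branch of parallel pairs through a pair *)

Lemma locally_pair (P Q : R -> Prop) (x y : R) :
  locally x P -> locally y Q -> locally (x, y) (fun p : R * R => P (fst p) /\ Q (snd p)).
Proof.
  intros [d Hd] [e He].
  exists (mkposreal _ (Rmin_stable_in_posreal d e)); intros [u v] [Hu Hv]; simpl in *.
  split; [apply Hd | apply He]; eapply ball_le.
  - apply (Rmin_l d e).
  - exact Hu.
  - apply (Rmin_r d e).
  - exact Hv.
Qed.

Definition dot (v w : R * R) : R := fst v * fst w + snd v * snd w.

Lemma dot_self_pos v : v <> (0, 0) -> 0 < dot v v.
Proof.
  destruct v as [a b]; unfold dot; simpl; intros Hv.
  destruct (Req_dec a 0) as [->|]; [|nra].
  destruct (Req_dec b 0) as [->|]; [now elim Hv | nra].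
Qed.

Lemma det_slope v a b :
  det v a * dot v b - det v b * dot v a = - dot v v * det a b.
Proof. unfold det, dot; ring. Qed.

(** Parallelism of two vectors not orthogonal to [v] becomes an equation between
    functions of one vector each: their slopes in the orthogonal frame of [v]. *)
Lemma parallel_iff_equal_slope v a b :
  dot v v <> 0 -> dot v a <> 0 -> dot v b <> 0 ->
  det a b = 0 <-> det v a * / dot v a = det v b * / dot v b.
Proof.
  intros Hv Ha Hb; pose proof (det_slope v a b) as Hd; split; intros H.
  - apply Rmult_eq_reg_r with (dot v a * dot v b); [|now apply Rmult_integral_contrapositive].
    transitivity (det v a * dot v b); [now field|].
    transitivity (det v b * dot v a); [|now field].
    rewrite H in Hd; lra.
  - assert (E : det v a * dot v b = det v b * dot v a).
    { transitivity (det v a * / dot v a * (dot v a * dot v b)); [now field|].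
      rewrite H; now field. }
    apply Rmult_eq_reg_l with (- dot v v); [|now apply Ropp_neq_0_compat].
    rewrite <- Hd, E; ring.
Qed.

(** Measured in the frame of [f' s2], the slope [m] of the tangent of [f] is a
    function of one parameter whose derivative at [s2] is a nonzero multiple of
    the curvature.  Parallelism near [(s1, s2)] reads [m s = m t], so it is
    solved by [t = h (m s)] with [h] a local inverse of [m] at [s2]: the
    one-variable inverse function theorem replaces the implicit function
    theorem. *)
Lemma parallel_graph f s1 s2 :
  closed_regular_curve f -> parallel_at f s1 s2 -> turning f s2 <> 0 ->
  exists (E : R -> Prop) tau,
    open E /\ E 0 /\ smooth_on E tau /\
    (forall u, E u -> parallel_at f (s1 + u) (tau u)) /\
    parallel_set_param f s1 s2 (fun u => s1 + u) tau.
Proof.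
  intros Hf Hpar Hk.
  set (v := curve_derive 1 f s2).
  set (p := fun t => det v (curve_derive 1 f t)).
  set (q := fun t => dot v (curve_derive 1 f t)).
  set (m := fun t => p t * / q t).
  set (D := fun t => q t <> 0).
  destruct (closed_curve_smooth f Hf) as [HX HY].
  apply smooth_on_derive in HX; apply smooth_on_derive in HY; try apply open_true.
  destruct HX as [_ HX], HY as [_ HY].
  assert (Sp : smooth_on (fun _ => True) p).
  { intros n; unfold p, det.
    apply (ndiff_ext n (fun _ => True)
             (fun t => fst v * Derive (fun x => snd (f x)) t
                       + (- snd v) * Derive (fun x => fst (f x)) t)).
    - intros t; unfold curve_derive; simpl; ring.
    - apply ndiff_plus; (apply ndiff_mult; [apply ndiff_const|]); [apply HY | apply HX]. }
  assert (Sq : smooth_on (fun _ => True) q).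
  { intros n; unfold q, dot, curve_derive; simpl.
    apply ndiff_plus; (apply ndiff_mult; [apply ndiff_const|]); [apply HX | apply HY]. }
  assert (Hv : 0 < dot v v) by (apply dot_self_pos, Hf).
  assert (HD : open D).
  { apply (open_comp q (fun z => z <> 0)); [|apply open_neq].
    intros t _; apply (ex_derive_continuous q t).
    exact (ndiff_ex_derive_n 1 _ q open_true (Sq _) t I). }
  (* [f' s1] is a nonzero multiple of [v], hence not orthogonal to it. *)
  assert (D1 : D s1).
  { unfold D, q.
    destruct (det_parallel (curve_derive 1 f s2) (curve_derive 1 f s1)) as [k Hkk].
    - apply Hf.
    - now apply parallel_at_sym.
    - fold v in Hkk; rewrite Hkk.
      assert (k <> 0).
      { intros ->; apply (proj2 Hf s1); rewrite Hkk; exact (scal_zero_l _). }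
      replace (dot v (scal k v)) with (k * dot v v)
        by (unfold dot, scal; simpl; unfold scal; simpl; unfold mult; simpl; ring).
      apply Rmult_integral_contrapositive; split; lra. }
  assert (D2 : D s2) by (unfold D, q; fold v; lra).
  assert (Sm : smooth_on D m).
  { intros n; apply ndiff_mult.
    - now apply (ndiff_sub n (fun _ => True)).
    - apply ndiff_inv; [trivial|now apply (ndiff_sub n (fun _ => True))]. }
  assert (Hparm : forall s t, D s -> D t -> parallel_at f s t <-> m s = m t).
  { intros s t Hs Ht; apply parallel_iff_equal_slope; trivial; lra. }
  (* As [p s2 = det v v = 0], the quotient rule gives [m' s2 = p' s2 / q s2]. *)
  assert (Hm' : Derive m s2 <> 0).
  { destruct (smooth_on_derive _ p open_true Sp) as [Dp _].
    destruct (smooth_on_derive _ q open_true Sq) as [Dq _].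
    assert (Hp0 : p s2 = 0) by apply det_diag.
    assert (Hp' : Derive p s2 = turning f s2).
    { apply is_derive_unique.
      replace (turning f s2)
        with (det (0, 0) (curve_derive 1 f s2) + det v (curve_derive 2 f s2))
        by (unfold turning, det, v; simpl; ring).
      apply (is_derive_det (fun _ => v)); [|now apply is_velocity_closed].
      split; apply @is_derive_const. }
    assert (Em : Derive m s2 = turning f s2 * / q s2).
    { apply is_derive_unique.
      replace (turning f s2 * / q s2)
        with ((Derive p s2 * q s2 - p s2 * Derive q s2) / q s2 ^ 2)
        by (rewrite Hp', Hp0; now field).
      apply is_derive_div; auto. }
    rewrite Em; apply Rmult_integral_contrapositive; split; trivial.
    now apply Rinv_neq_0_compat. }
  destruct (local_inverse D m s2 HD D2 Sm Hm') as [F [h [HF [F2 [Sh [Hmh Hhm]]]]]].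
  assert (Em : m s1 = m s2) by now apply Hparm.
  set (E := fun u => D (s1 + u) /\ F (m (s1 + u))).
  set (tau := fun u => h (m (s1 + u))).
  assert (HE : open E).
  { apply (open_comp (fun u => s1 + u) (fun t => D t /\ F (m t))).
    - intros u _; apply (ex_derive_continuous (fun z => s1 + z)); auto_derive; trivial.
    - intros t [Ht1 Ht2]; apply filter_and; [now apply HD|].
      apply (ex_derive_continuous m t); [|now apply HF].
      exact (ndiff_ex_derive_n 1 D m HD (Sm _) t Ht1). }
  assert (E0 : E 0) by (unfold E; rewrite Rplus_0_r, Em; now split).
  assert (Ssig : smooth_on E (fun u => s1 + u)).
  { intros n; apply ndiff_plus; [apply ndiff_const | apply ndiff_id]. }
  assert (Stau : smooth_on E tau).
  { intros n; apply (ndiff_comp n F E h (fun u => m (s1 + u))).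
    - intros u Hu; apply Hu.
    - apply Sh.
    - apply (ndiff_comp n D E m (fun u => s1 + u)); trivial; intros u Hu; apply Hu. }
  assert (Hpt : forall u, E u -> parallel_at f (s1 + u) (tau u)).
  { intros u [Hu1 Hu2]; destruct (Hmh _ Hu2) as [Hd Hm].
    apply Hparm; trivial; now symmetry. }
  exists E, tau; do 4 (split; [assumption|]).
  repeat split.
  - apply Rplus_0_r.
  - unfold tau; rewrite Rplus_0_r, Em; exact (locally_singleton _ _ Hhm).
  - now apply (smooth_on_near E).
  - now apply (smooth_on_near E).
  - intros H; apply (f_equal fst) in H.
    apply R1_neq_R0; refine (eq_trans (eq_sym _) H).
    apply (is_derive_unique (fun x => s1 + x)); auto_derive; trivial; ring.
  - now apply (locally_open E).
  - intros P HP.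
    assert (HP1 : locally s1 (fun s => D s /\ P (s - s1))).
    { apply filter_and; [now apply HD|].
      apply locally_shift; revert HP; apply filter_imp; intros u Hu.
      replace (s1 + u - s1) with (u : R) by (simpl in u; ring); trivial. }
    assert (HP2 : locally s2 (fun t => D t /\ h (m t) = t)).
    { apply filter_and; [now apply HD | trivial]. }
    generalize (locally_pair _ _ _ _ HP1 HP2); apply filter_imp.
    intros [s t] [[Hs1 Hs2] [Ht1 Ht2]] Hst; simpl in *.
    exists (s - s1); split; trivial.
    assert (Hs : s1 + (s - s1) = s) by ring.
    split; trivial; unfold tau; rewrite Hs.
    apply Hparm in Hst; trivial; now rewrite Hst.
Qed.

(** * Inflexions of the curve produce inflexions of the caustic *)

Lemma secant_caustic_parallel_pair f s t :
  parallel_pair f s t -> secant_caustic f (minus (f s) (f t)).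
Proof.
  intros Hp P HP; exists (minus (f s) (f t)); split.
  - exact (locally_singleton _ _ HP).
  - now exists s, t.
Qed.

(** With [s] itself as parameter of the branch, [sigma' = 1], and the vanishing
    curvature at [s1] forces [tau' = 0] there.  The velocity of the branch is
    then [f' s1], so the point is regular, and the curvature of the branch has
    the sign of that of [f]. *)
Lemma inflexion_caustic_inflexion f s1 s2 :
  closed_regular_curve f -> parallel_pair f s1 s2 ->
  inflexion f s1 -> turning f s2 <> 0 -> secant_caustic_inflexion f s1 s2.
Proof.
  intros Hf Hpp Hi Hk2.
  assert (Hk1 : turning f s1 = 0) by now apply inflexion_turning_zero.
  split.
  { now apply secant_caustic_parallel_pair. }
  destruct (parallel_graph f s1 s2 Hf (proj2 Hpp) Hk2)
    as [E [tau [HE [E0 [Stau [Hpt Hps]]]]]].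
  exists (fun u => s1 + u), tau; split; trivial.
  assert (Ssig : smooth_on E (fun u => s1 + u)).
  { intros n; apply ndiff_plus; [apply ndiff_const | apply ndiff_id]. }
  assert (Dsig : forall u, Derive (fun u => s1 + u) u = 1).
  { intros u; apply is_derive_unique; auto_derive; trivial; ring. }
  assert (Es : s1 + 0 = s1) by apply Rplus_0_r.
  assert (Et : tau 0 = s2) by apply Hps.
  destruct (det_parallel (curve_derive 1 f s1) (curve_derive 1 f s2)) as [k Hkk];
    [apply Hf | apply Hpp |].
  destruct (det_parallel (curve_derive 1 f s2) (curve_derive 1 f s1)) as [k' Hkk'];
    [apply Hf | now apply parallel_at_sym, Hpp |].
  assert (Hk'0 : k' <> 0).
  { intros ->; apply (proj2 Hf s1); rewrite Hkk'; exact (scal_zero_l _). }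
  (* In the differentiated parallelism condition the first term is a multiple of
     the curvature at [s1], hence zero, and the coefficient of [tau'] is a nonzero
     multiple of the curvature at [s2]. *)
  assert (Dtau : Derive tau 0 = 0).
  { pose proof (parallel_constraint f E _ tau 0 Hf HE Ssig Stau Hpt E0) as Hc.
    rewrite Dsig, Es, Et in Hc.
    rewrite Hkk, det_scal_r, (det_antisym (curve_derive 2 f s1)) in Hc.
    fold (turning f s1) in Hc; rewrite Hk1 in Hc.
    rewrite Hkk', det_scal_l in Hc; fold (turning f s2) in Hc.
    apply Rmult_eq_reg_r with (k' * turning f s2);
      [|now apply Rmult_integral_contrapositive].
    lra. }
  assert (Hreg : regular_at (difference_curve f (fun u => s1 + u) tau) 0).
  { unfold regular_at; rewrite (difference_curve_velocity f E) by trivial.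
    rewrite Dsig, Dtau, Es.
    assert (T : forall a b : R * R, minus (scal 1 a) (scal 0 b) = a).
    { intros a b; transitivity (minus a zero); [|apply minus_zero_r].
      apply (f_equal2 minus); [exact (scal_one a) | exact (scal_zero_l b)]. }
    rewrite T; apply Hf. }
  split; [exact Hreg|].
  apply (difference_curve_changes_sign f E (fun u => s1 + u) tau 0); trivial.
  apply changes_sign_ext with (g := fun u => signed_curvature f (s1 + u)).
  - apply filter_forall; intros u; rewrite Dsig, Rmult_1_l; apply signed_curvature_sign.
  - now apply changes_sign_shift.
Qed.

(** * Exchanging the two points of a pair *)

Lemma parallel_pair_sym f s t : parallel_pair f s t -> parallel_pair f t s.
Proof.
  intros [Hne Hp]; split; [|now apply parallel_at_sym].
  intros E; now apply Hne.
Qed.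

Lemma parallel_set_param_sym f s1 s2 sigma tau :
  parallel_set_param f s1 s2 sigma tau -> parallel_set_param f s2 s1 tau sigma.
Proof.
  intros [[Es Et] [[Ss St] [Hreg [Hpar Hcov]]]].
  split; [now split|]; split; [now split|]; split; [|split].
  - intros H; apply Hreg; unfold curve_derive in *; simpl in *.
    injection H; intros H1 H2; now rewrite H1, H2.
  - revert Hpar; apply filter_imp; intros u; apply parallel_at_sym.
  - intros P HP; destruct (Hcov P HP) as [e He]; exists e.
    intros [t s] [Ht Hs] Hts.
    destruct (He (s, t) (conj Hs Ht) (parallel_at_sym _ _ _ Hts)) as [u [Hu [H1 H2]]].
    now exists u.
Qed.

Lemma curve_derive_opp n (c : R -> R * R) u :
  curve_derive n (fun x => opp (c x)) u = opp (curve_derive n c u).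
Proof.
  unfold curve_derive; simpl.
  apply (f_equal2 pair); apply Derive_n_opp.
Qed.

Lemma signed_curvature_opp c u :
  signed_curvature (fun x => opp (c x)) u = signed_curvature c u.
Proof.
  unfold signed_curvature; rewrite !curve_derive_opp; apply (f_equal2 Rdiv).
  - unfold det; simpl; unfold opp; simpl; ring.
  - apply (f_equal (fun z => z ^ 3)); exact (norm_opp (curve_derive 1 c u)).
Qed.

(** Exchanging the points reflects the caustic in the origin, an orientation
    preserving map that leaves signed curvature unchanged. *)
Lemma secant_caustic_inflexion_sym f s1 s2 :
  parallel_pair f s1 s2 ->
  secant_caustic_inflexion f s1 s2 -> secant_caustic_inflexion f s2 s1.
Proof.
  intros Hpp [_ [sigma [tau [Hps [Hreg Hcs]]]]].
  split; [now apply secant_caustic_parallel_pair, parallel_pair_sym|].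
  exists tau, sigma; split; [now apply parallel_set_param_sym|]; cbv zeta.
  set (c := fun u => minus (f (sigma u)) (f (tau u))) in *.
  replace (fun u => minus (f (tau u)) (f (sigma u))) with (fun u => opp (c u)).
  - split.
    + unfold regular_at; rewrite curve_derive_opp; intros H; apply Hreg.
      rewrite <- (opp_opp (curve_derive 1 c 0)), H; exact opp_zero.
    + revert Hcs; apply changes_sign_ext, filter_forall.
      intros u; rewrite signed_curvature_opp; split; reflexivity.
  - apply functional_extensionality; intros u; apply opp_minus.
Qed.

Theorem proposition2p14 :
  forall (f : R -> R * R) (s1 s2 : R),
    generic f ->
    parallel_pair f s1 s2 ->
    (secant_caustic_inflexion f s1 s2 /\ secant_caustic_inflexion f s2 s1) <->
    (inflexion f s1 \/ inflexion f s2).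
Proof.
  intros f s1 s2 Hg Hpp; pose proof (generic_regular f Hg) as Hf; split.
  - intros [Hs _].
    destruct (caustic_inflexion_turning f s1 s2 Hf Hs) as [H|H]; [left|right];
      now apply turning_zero_inflexion.
  - assert (T : forall s t, parallel_pair f s t -> inflexion f s ->
      secant_caustic_inflexion f s t).
    { intros s t Hst Hi; apply inflexion_caustic_inflexion; trivial.
      intros H; apply turning_zero_inflexion in H; trivial.
      now destruct (generic_parallel f Hg s t Hst). }
    pose proof (parallel_pair_sym _ _ _ Hpp) as Hpp'.
    intros [Hi|Hi].
    + split; [|apply secant_caustic_inflexion_sym; trivial]; now apply T.
    + split; [apply secant_caustic_inflexion_sym; trivial|]; now apply T.
Qed.
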